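(* Let $k,t$ be integers with $k\geq 7$ and $k\geq t+1$, and let $H$ be a non-empty graph of order $t$. Then $$\operatorname{gr}_k(P_5:H)=\left\lceil\frac{1+\sqrt{1+8k}}{2}\right\rceil .$$
   Context: All graphs are finite, simple and undirected; a graph is non-empty if it has at least one edge; the order of a graph is its number of vertices. $K_n$ is the complete graph on $n$ vertices and $P_5$ is the path with $5$ vertices and $4$ edges. A $k$-edge-coloring assigns to each edge one of $k$ colors; all $k$-edge-colorings are assumed exact, i.e. each of the $k$ colors is used at least once. An edge-colored graph is rainbow if all its edges have different colors and monochromatic if all its edges have a single color. A copy of a graph means a (not necessarily induced) subgraph isomorphic to it. For non-empty graphs $G,H$ and a positive integer $k$, the Gallai-Ramsey number $\operatorname{gr}_k(G:H)$ is the minimum integer $N$ with $\binom{N}{2}\geq k$ (so that $K_N$ admits a $k$-edge-coloring) such that for all $n\geq N$, every $k$-edge-coloring of $K_n$ contains either a rainbow copy of $G$ or a monochromatic copy of $H$. *)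

(* Defs.v *)
From HB Require Import structures.
From mathcomp Require Import all_boot all_order all_algebra.
From mathcomp Require Import reals.

Set Implicit Arguments.
Unset Strict Implicit.
Unset Printing Implicit Defensive.

Record sgraph := SGraph {
  vertex :> finType;
  adj : rel vertex;
  adj_sym : symmetric adj;
  adj_irrefl : irreflexive adj }.

Definition edges (G : sgraph) : {set {set G}} :=
  [set [set p.1; p.2] | p in [set p : G * G | adj p.1 p.2]].

Definition nonempty_graph (G : sgraph) : Prop := edges G != set0.

Section Complete.
Variable n : nat.

Definition complete_adj : rel 'I_n := fun x y => x != y.

Lemma complete_adj_sym : symmetric complete_adj.
Proof. by move=> x y; rewrite /complete_adj eq_sym. Qed.

Lemma complete_adj_irrefl : irreflexive complete_adj.
Proof. by move=> x; rewrite /complete_adj eqxx. Qed.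

Definition complete_graph : sgraph :=
  SGraph complete_adj_sym complete_adj_irrefl.

End Complete.

Section Path.
Variable n : nat.

Definition path_adj : rel 'I_n :=
  fun x y => (x.+1 == y :> nat) || (y.+1 == x :> nat).

Lemma path_adj_sym : symmetric path_adj.
Proof. by move=> x y; rewrite /path_adj orbC. Qed.

Lemma path_adj_irrefl : irreflexive path_adj.
Proof. by move=> x; rewrite /path_adj orbb gtn_eqF. Qed.

(* [n] counts vertices, so P_5 is [path_graph 5]. *)
Definition path_graph : sgraph := SGraph path_adj_sym path_adj_irrefl.

End Path.

(* A copy of [G] in [F] is the image of such an [f]: the copy's edges are the
   [f @: e] for [e \in edges G], and it need not be induced. *)
Definition embedding (G F : sgraph) (f : G -> F) : Prop :=
  injective f /\ (forall x y : G, adj x y -> adj (f x) (f y)).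

Section Colorings.
Variables (k : nat) (F : sgraph).

(* A coloring is a function on all vertex sets; only its values on [edges F]
   are ever used. *)
Definition exact_coloring (c : {set F} -> 'I_k) : Prop :=
  forall a : 'I_k, exists2 e, e \in edges F & c e = a.

Definition rainbow_copy (c : {set F} -> 'I_k) (G : sgraph) : Prop :=
  exists f : G -> F,
    embedding f /\ {in edges G &, injective (fun e : {set G} => c (f @: e))}.

Definition monochromatic_copy (c : {set F} -> 'I_k) (H : sgraph) : Prop :=
  exists f : H -> F,
    embedding f /\
    exists a : 'I_k, {in edges H, forall e : {set H}, c (f @: e) = a}.

End Colorings.

Definition gallai_ramsey_bound (k : nat) (G H : sgraph) (N : nat) : Prop :=
  k <= 'C(N, 2) /\
  forall n : nat, N <= n ->
    forall c : {set complete_graph n} -> 'I_k, exact_coloring c ->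
      rainbow_copy c G \/ monochromatic_copy c H.

(* [is_gallai_ramsey k G H N] says that the minimum defining gr_k(G : H) exists
   and equals [N]. *)
Definition is_gallai_ramsey (k : nat) (G H : sgraph) (N : nat) : Prop :=
  gallai_ramsey_bound k G H N /\
  forall M : nat, gallai_ramsey_bound k G H M -> N <= M.

(* Main.v *)
(* Let c be an edge-coloring of K_n with at least 7 colors and no rainbow P_5.
   If some vertex a sees at least 4 colors, then K_n - a is monochromatic.
   No vertex can see exactly 3 colors when none sees more: edges of the
   remaining (at least 4) colors cannot pairwise meet, and two disjoint ones
   of different colors extend to a rainbow P_5 through a.  If every vertex sees
   at most 2 colors, these color sets pairwise intersect, so they share a color,
   and choosing one vertex on an edge of each other color gives a monochromatic
   clique.  In all cases there is a monochromatic clique on k - 1 >= t vertices,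
   so only the requirement binomial(N, 2) >= k determines the Gallai-Ramsey
   number. *)
Require Import Defs.
From HB Require Import structures.
From mathcomp Require Import all_boot all_order all_algebra.
From mathcomp Require Import reals.
From mathcomp Require Import boolp zify lra.

Set Implicit Arguments.
Unset Strict Implicit.
Unset Printing Implicit Defensive.

Import Order.TTheory GRing.Theory Num.Theory.

(** * Colorings of vertex pairs without a rainbow path on five vertices *)

Section RainbowP5Free.
Variables (T K : finType) (c : T -> T -> K).
Hypothesis csym : forall x y, c x y = c y x.
Hypothesis no_rainbow : forall v1 v2 v3 v4 v5, uniq [:: v1; v2; v3; v4; v5] ->
  uniq [:: c v1 v2; c v2 v3; c v3 v4; c v4 v5] -> False.

(** Closes a case by the path [v1 v2 v3 v4 v5]. Vertices are often told apart by [congruence]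
    through their different colors towards a common vertex. *)
Ltac rainbow v1 v2 v3 v4 v5 :=
  exfalso; apply: (@no_rainbow v1 v2 v3 v4 v5);
  move: (csym v1 v2) (csym v2 v3) (csym v3 v4) (csym v4 v5) => ? ? ? ?;
  rewrite /= !inE !negb_or;
  repeat (apply/andP; split); try done; apply/eqP => ?; congruence.

Ltac distinct := rewrite /= ?inE ?negb_or;
  repeat (apply/andP; split); try done; apply/eqP; congruence.

(** * A vertex with at least four colors besides [g] *)

Section RichVertex.
Variables (a : T) (g : K).
Let good x := x <> a /\ c a x <> g.
Hypothesis rich : forall i j l,
  exists x, [/\ good x, c a x <> i, c a x <> j & c a x <> l].

(** If [y] and [z] look alike from [a], take [x], [w] of two further colors. Unless [x w] or [x y]
    has color [g], the colors of both are forced and [z y x w a] is rainbow. *)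
Lemma rich_cross_edge y z : good y -> good z -> y <> z -> c y z = g ->
  exists y' z', [/\ good y', good z', c a y' <> c a z' & c y' z' = g].
Proof.
move=> [ya yg] [za zg] yz cyz.
have [fyz|fyz] := eqVneq (c a y) (c a z); last first.
  by exists y, z; split => //; apply/eqP.
have [x [[xa xg] xi _ _]] := rich (c a y) g g.
have [w [[wa wg] wi wx _]] := rich (c a y) (c a x) g.
have [u [[ua ug] ui ux uw]] := rich (c a y) (c a x) (c a w).
have [cxw|/eqP cxw] := eqVneq (c x w) g.
  by exists x, w; split => //; exact: nesym.
have [cxy|/eqP cxy] := eqVneq (c x y) g; first by exists x, y; split.
have cxw_y : c x w = c a y.
  apply/eqP/negPn/negP => /eqP cxwy.
  have [cxwx|/eqP cxwx] := eqVneq (c x w) (c a x); last by rainbow z y a x w.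
  by rainbow z y a w x.
have cxy_x : c x y = c a x.
  apply/eqP/negPn/negP => /eqP cxyx.
  have [cxyw|/eqP cxyw] := eqVneq (c x y) (c a w); last by rainbow z y x a w.
  by rainbow z y x a u.
by rainbow z y x w a.
Qed.

(** Otherwise [y z] and [x w], suitably oriented and joined through [a], form a rainbow path. *)
Lemma opposite_edge y z x w : good y -> good z -> good x -> good w ->
  uniq [:: c a y; c a z; c a x; c a w] -> c y z = g -> c x w = g.
Proof.
move=> [ya yg] [za zg] [xa xg] [wa wg].
rewrite /= !inE !negb_or andbT.
case/and3P=> /and3P[/eqP yz /eqP yx /eqP yw] /andP[/eqP zx /eqP zw] /eqP xw cyz.
apply/eqP/negPn/negP => /eqP cxw.
have [cxwx|/eqP cxwx] := eqVneq (c x w) (c a x); first by rainbow z y a w x.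
have [cxwy|/eqP cxwy] := eqVneq (c x w) (c a y); first by rainbow y z a x w.
by rainbow z y a x w.
Qed.

(** If [x y] did not have color [g], the path [z a w x y] would leave it only the colors of [a z]
    and [a w]; in either case every color of [z w] yields a rainbow path. *)
Lemma side_edge y z x w : good y -> good z -> good x -> good w ->
  uniq [:: c a y; c a z; c a x; c a w] -> c y z = g -> c x y = g.
Proof.
move=> gy gz gx gw u cyz; have cxw := opposite_edge gy gz gx gw u cyz.
case: gy gz gx gw u cyz cxw => [ya yg] [za zg] [xa xg] [wa wg].
rewrite /= !inE !negb_or andbT.
case/and3P=> /and3P[/eqP yz /eqP yx /eqP yw] /andP[/eqP zx /eqP zw] /eqP xw cyz cxw.
apply/eqP/negPn/negP => /eqP cxy.
have [cxyz|/eqP cxyz] := eqVneq (c x y) (c a z).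
  have [czw|/eqP czw] := eqVneq (c z w) (c a x); first by rainbow x y a w z.
  have [czw'|/eqP czw'] := eqVneq (c z w) (c a y); first by rainbow y x a w z.
  have [czwg|/eqP czwg] := eqVneq (c z w) g; first by rainbow y x a w z.
  by rainbow y a x w z.
have [cxyw|/eqP cxyw] := eqVneq (c x y) (c a w); last by rainbow z a w x y.
have [czw|/eqP czw] := eqVneq (c z w) (c a y); first by rainbow y x a z w.
have [czw'|/eqP czw'] := eqVneq (c z w) (c a x); first by rainbow x y a z w.
have [czwg|/eqP czwg] := eqVneq (c z w) g; first by rainbow x y a z w.
by rainbow x a y z w.
Qed.

(** Color [g] passes from [u v] to the opposite edge [q w], where [w] has a fourth color at [a],
    then back to [p v], and finally to the side [p q]. *)
Lemma adjacent_edge u v p q : good u -> good v -> good p -> good q ->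
  c a u <> c a v -> c a p = c a u -> c a q <> c a u -> c a q <> c a v ->
  c u v = g -> c p q = g.
Proof.
move=> gu gv gp gq uv pu qu qv cuv.
have [w [gw wu wv wq]] := rich (c a u) (c a v) (c a q).
have cqw : c q w = g by apply: (@opposite_edge u v q w) => //; distinct.
have cpv : c p v = g.
  by rewrite csym; apply: (@opposite_edge q w v p) => //; distinct.
by rewrite csym; apply: (@side_edge p v q w) => //; distinct.
Qed.

(** The colors of [p], [q] at [a] share none, one or both with those of [y], [z]. When both are
    shared, the opposite edge [x w] is the intermediary. *)
Lemma rich_cross_mono y z p q : good y -> good z -> good p -> good q ->
  c a y <> c a z -> c y z = g -> c a p <> c a q -> c p q = g.
Proof.
move=> gy gz gp gq yz cyz pq.
have [x [gx xy xz _]] := rich (c a y) (c a z) g.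
have [w [gw wy wz wx]] := rich (c a y) (c a z) (c a x).
have cxw : c x w = g by apply: (@opposite_edge y z x w) => //; distinct.
have czy : c z y = g by rewrite csym.
have [py|/eqP py] := eqVneq (c a p) (c a y).
  have [qz|/eqP qz] := eqVneq (c a q) (c a z).
    by apply: (@opposite_edge x w p q) => //; distinct.
  by apply: (@adjacent_edge y z p q) => //; congruence.
have [pz|/eqP pz] := eqVneq (c a p) (c a z).
  have [qy|/eqP qy] := eqVneq (c a q) (c a y).
    by apply: (@opposite_edge x w p q) => //; distinct.
  by apply: (@adjacent_edge z y p q) => //; congruence.
have [qy|/eqP qy] := eqVneq (c a q) (c a y).
  by rewrite csym; apply: (@adjacent_edge y z q p) => //; congruence.
have [qz|/eqP qz] := eqVneq (c a q) (c a z).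
  by rewrite csym; apply: (@adjacent_edge z y q p) => //; congruence.
by apply: (@opposite_edge y z p q) => //; distinct.
Qed.

Lemma rich_mono y0 z0 : good y0 -> good z0 -> y0 <> z0 -> c y0 z0 = g ->
  forall p q, p <> a -> q <> a -> p <> q -> c p q = g.
Proof.
move=> gy0 gz0 yz0 cyz0.
have [y1 [z1 [gy1 gz1 yz1 cyz1]]] := rich_cross_edge gy0 gz0 yz0 cyz0.
have cross p q : good p -> good q -> c a p <> c a q -> c p q = g.
  by move=> gp gq; apply: (rich_cross_mono gy1 gz1 gp gq yz1 cyz1).
(* Three further colors at [a] are picked. The color of [p q] uses up at most one of them, so two
   are left for a path from [p] over [q] and [a] whose second edge has color [g]. *)
have inner p q : good q -> p <> a -> p <> q ->
    c a p = g \/ c a p = c a q -> c p q = g.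
  move=> gq pa pq fp; apply/eqP/negPn/negP => /eqP cpq.
  have [y [gy yq _ _]] := rich (c a q) g g.
  have [z [gz zq zy _]] := rich (c a q) (c a y) g.
  have [w [gw wq wy wz]] := rich (c a q) (c a y) (c a z).
  have cqy : c q y = g by apply: cross => //; exact: nesym.
  have cqz : c q z = g by apply: cross => //; exact: nesym.
  case: gq gy gz gw => [qa qg] [ya yg] [za zg] [wa wg].
  have py : p <> y by case: fp => ? ?; congruence.
  have pz : p <> z by case: fp => ? ?; congruence.
  have pw : p <> w by case: fp => ? ?; congruence.
  have [e|/eqP e] := eqVneq (c p q) (c a y); first by rainbow p q z a w.
  have [e'|/eqP e'] := eqVneq (c p q) (c a z); first by rainbow p q y a w.
  by rainbow p q y a z.
have half p q : good q -> p <> a -> p <> q -> c p q = g.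
  move=> gq pa pq.
  have [fp|/eqP fp] := eqVneq (c a p) g; first by apply: inner => //; left.
  have [fpq|/eqP fpq] := eqVneq (c a p) (c a q).
    by apply: inner => //; right.
  exact: cross.
move=> p q pa qa pq.
have [fq|/eqP fq] := eqVneq (c a q) g; last exact: half.
have [fp|/eqP fp] := eqVneq (c a p) g; last first.
  by rewrite csym; apply: half => //; exact: nesym.
(* Both ends now have color [g] at [a]. The path of [inner] works again, since [half] gives color
   [g] to the edges from [q] to [y] and [z]. *)
apply/eqP/negPn/negP => /eqP cpq.
have [y [gy _ _ _]] := rich g g g.
have [z [gz zy _ _]] := rich (c a y) g g.
have [w [gw wy wz _]] := rich (c a y) (c a z) g.
have qy : q <> y by case: gy => ? ? ?; congruence.
have qz : q <> z by case: gz => ? ? ?; congruence.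
have cqy : c q y = g by apply: half.
have cqz : c q z = g by apply: half.
case: gy gz gw => [ya yg] [za zg] [wa wg].
have [e|/eqP e] := eqVneq (c p q) (c a y); first by rainbow p q z a w.
have [e'|/eqP e'] := eqVneq (c p q) (c a z); first by rainbow p q y a w.
by rainbow p q y a z.
Qed.

End RichVertex.

(** Paths that start with one of the two edges and continue through [a] force [x w] to have the
    color of [a y]; then every color of [x y] yields a rainbow path. *)
Lemma two_foreign_edges a y z y' z' x w :
  y <> a -> z <> a -> y' <> a -> z' <> a -> x <> a -> w <> a ->
  uniq [:: y; z; y'; z'] -> c y z <> c y' z' ->
  c a z = c a y -> c a y' = c a y -> c a z' = c a y ->
  uniq [:: c a y; c a x; c a w; c y z] ->
  uniq [:: c a y; c a x; c a w; c y' z'] -> False.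
Proof.
move=> ya za y'a z'a xa wa.
rewrite /= !inE !negb_or !andbT.
move=> /and3P[/and3P[/eqP ? /eqP ? /eqP ?] /andP[/eqP ? /eqP ?] /eqP ?].
move=> gg' fz fy' fz'.
move=> /and3P[/and3P[/eqP ? /eqP ? /eqP ?] /andP[/eqP ? /eqP ?] /eqP ?].
move=> /and3P[/and3P[/eqP ? /eqP ? /eqP ?] /andP[/eqP ? /eqP ?] /eqP ?].
have cxw : c x w = c a y.
  apply/eqP/negPn/negP => /eqP cxwy.
  have [e|/eqP e] := eqVneq (c x w) (c y z); first by rainbow z' y' a x w.
  have [e'|/eqP e'] := eqVneq (c x w) (c a x); last by rainbow z y a x w.
  by rainbow z y a w x.
have [e|/eqP e] := eqVneq (c x y) (c y z); first by rainbow z' y' a x y.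
have [e'|/eqP e'] := eqVneq (c x y) (c a w); first by rainbow z' y' a x y.
have [e2|/eqP e2] := eqVneq (c x y) (c a x); first by rainbow z y x w a.
by rainbow z y x a w.
Qed.

(** * Sets of colors seen by the vertices *)

Definition colors_at v : {set K} := [set c v x | x in [set~ v]].

Lemma colors_atP v g :
  reflect (exists2 x, x <> v & c v x = g) (g \in colors_at v).
Proof.
apply: (iffP imsetP) => [[x]|[x xv <-]].
  by rewrite !inE => /eqP xv ->; exists x.
by exists x => //; rewrite !inE; apply/eqP.
Qed.

Lemma mem_colors_at v x : x <> v -> c v x \in colors_at v.
Proof. by move=> xv; apply/colors_atP; exists x. Qed.

Lemma uniq_sub_card (A : {set K}) (s : seq K) :
  uniq s -> all (mem A) s -> size s <= #|A|.
Proof.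
move=> us sA; rewrite -(card_uniqP us); apply: subset_leq_card.
by apply/subsetP => x xs; exact: (allP sA).
Qed.

Lemma pick_fresh (A : {set K}) (s : seq K) :
  size s < #|A| -> exists2 x, x \in A & x \notin s.
Proof.
move=> sA; case: (pickP [pred x | (x \in A) && (x \notin s)]) => [x /andP[]|no].
  by exists x.
have : #|A| <= #|s|.
  apply: subset_leq_card; apply/subsetP => x xA.
  by have /= := no x; rewrite xA => /negbFE.
by rewrite leqNgt (leq_ltn_trans (card_size s)).
Qed.

(** * All colors used: vertices with at least four, three, or at most two colors *)

Hypothesis csurj : forall g, exists x y, x <> y /\ c x y = g.

Lemma foreign_edge a g : g \notin colors_at a ->
  exists y z, [/\ y <> a, z <> a, y <> z & c y z = g].
Proof.
move=> gN; have [y [z [yz cyz]]] := csurj g.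
exists y, z; split => // [ya|za]; move: gN; rewrite -cyz.
  by rewrite ya mem_colors_at //; congruence.
by rewrite za csym mem_colors_at //; congruence.
Qed.

(** By [rich_mono] it is enough to find an edge off [a] whose color [g] differs from those of its
    ends at [a], with four colors other than [g] at [a]. An edge of a color missing at [a] will do;
    if none is missing, [a] sees at least five colors and only the first condition is at stake. *)
Lemma star_mono a : 4 <= #|colors_at a| -> 5 <= #|K| ->
  exists g, forall p q, p <> a -> q <> a -> p <> q -> c p q = g.
Proof.
move=> Ca4 K5.
suff [g [y [z [[ya za yz cyz] fy fz Cg]]]] : exists g y z,
    [/\ [/\ y <> a, z <> a, y <> z & c y z = g], c a y <> g, c a z <> g &
       4 <= #|colors_at a :\ g|].
  exists g; apply: (@rich_mono a g _ y z) => //.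
  move=> i j l; have [f] := @pick_fresh (colors_at a :\ g) [:: i; j; l] Cg.
  rewrite !inE !negb_or => /andP[fg /colors_atP[x xa cx]]; rewrite -{f}cx in fg *.
  by case/and3P=> /eqP ? /eqP ? /eqP ?; exists x; do 2?split => //; apply/eqP.
case: (pickP [pred g | g \notin colors_at a]) => [g /= gN|Call].
  have [y [z [ya za yz cyz]]] := foreign_edge gN.
  exists g, y, z; split => // [e|e|].
  - by move: gN; rewrite -e mem_colors_at.
  - by move: gN; rewrite -e mem_colors_at.
  - by move: Ca4; rewrite (cardsD1 g) (negbTE gN).
have CT : colors_at a = setT.
  by apply/setP => g; have /= := Call g; rewrite inE => /negbFE.
have nbr s : size s < 5 -> exists2 x, x <> a & c a x \notin s.
  move=> s5; have [|f /colors_atP[x xa <-]] := @pick_fresh (colors_at a) s.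
    by rewrite CT cardsT; exact: leq_trans K5.
  by exists x.
have [x1 a1 _] := nbr [::] isT.
have [x2 a2 n2] := nbr [:: c a x1] isT.
have [x3 a3 n3] := nbr [:: c a x1; c a x2] isT.
have [x4 a4 n4] := nbr [:: c a x1; c a x2; c a x3] isT.
move: n2 n3 n4; rewrite !inE !negb_or => /eqP n21 /andP[/eqP n31 /eqP n32].
case/and3P=> /eqP n41 /eqP n42 /eqP n43.
have found y z : y <> a -> z <> a -> y <> z ->
    c y z <> c a y -> c y z <> c a z ->
    exists g y z, [/\ [/\ y <> a, z <> a, y <> z & c y z = g],
      c a y <> g, c a z <> g & 4 <= #|colors_at a :\ g|].
  move=> ya za yz cy cz; exists (c y z), y, z; split=> //; try exact: nesym.
  by move: K5; rewrite -cardsT -CT (cardsD1 (c y z)) CT inE.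
(* If each of x1 x2 and x3 x4 has the color of one of its ends at a, then the
   path through a joining the other two ends is rainbow. *)
have x12 : x1 <> x2 by congruence.
have x34 : x3 <> x4 by congruence.
have [e1|/eqP e1] := eqVneq (c x1 x2) (c a x1);
  have [e2|/eqP e2] := eqVneq (c x1 x2) (c a x2); try congruence;
  try (by apply: (found x1 x2));
  have [e3|/eqP e3] := eqVneq (c x3 x4) (c a x3);
  have [e4|/eqP e4] := eqVneq (c x3 x4) (c a x4); try congruence;
  try (by apply: (found x3 x4)).
- by rainbow x1 x2 a x4 x3.
- by rainbow x1 x2 a x3 x4.
- by rainbow x2 x1 a x4 x3.
- by rainbow x2 x1 a x3 x4.
Qed.

(** Disjoint edges joined through [a] form a rainbow path unless the joined ends have the same color
    at [a]. So all four ends agree, and two further colors at [a] lead to [two_foreign_edges]. *)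
Lemma foreign_edges_meet a y z y' z' : 3 <= #|colors_at a| ->
  y <> a -> z <> a -> y' <> a -> z' <> a ->
  c y z \notin colors_at a -> c y' z' \notin colors_at a ->
  c y z <> c y' z' -> ~~ uniq [:: y; z; y'; z'].
Proof.
move=> Ca3 ya za y'a z'a gN gN' gg'; apply/negP => u.
have far v h : v <> a -> h \notin colors_at a -> c a v <> h.
  by move=> va hN e; move: hN; rewrite -e mem_colors_at.
have agree y1 z1 y2 z2 : y1 <> a -> z1 <> a -> y2 <> a -> z2 <> a ->
    uniq [:: y1; z1; y2; z2] -> c y1 z1 = c y z -> c y2 z2 = c y' z' ->
    c a y1 = c a y2.
  move=> y1a z1a y2a z2a; rewrite /= !inE !negb_or !andbT.
  move=> /and3P[/and3P[/eqP ? /eqP ? /eqP ?] /andP[/eqP ? /eqP ?] /eqP ?] e1 e2.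
  have ? := far y1 _ y1a gN; have ? := far y1 _ y1a gN'.
  have ? := far y2 _ y2a gN; have ? := far y2 _ y2a gN'.
  apply/eqP/negPn/negP => /eqP ne.
  by rainbow z1 y1 a y2 z2.
have fy' : c a y' = c a y by apply/esym/(agree y z y' z').
have u' : uniq [:: y; z; z'; y'].
  move: u; rewrite /= !inE !negb_or (eq_sym y').
  by case/and4P=> /and3P[-> -> ->] /andP[-> ->] ->.
have u2 : uniq [:: z; y; y'; z'].
  move: u; rewrite /= !inE !negb_or (eq_sym y z).
  by case/and4P=> /and3P[-> -> ->] /andP[-> ->] ->.
have fz' : c a z' = c a y by apply/esym/(agree y z z' y') => //; rewrite csym.
have fz : c a z = c a y.
  by rewrite -fy'; apply: (agree z y y' z') => //; rewrite csym.
have [_ /colors_atP[x xa <-]] := @pick_fresh _ [:: c a y] (ltnW Ca3).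
rewrite inE => /eqP nx.
have [_ /colors_atP[w wa <-]] := @pick_fresh _ [:: c a y; c a x] Ca3.
rewrite !inE negb_or => /andP[/eqP nwy /eqP nwx].
have ? := far x _ xa gN; have ? := far x _ xa gN'.
have ? := far w _ wa gN; have ? := far w _ wa gN'.
have ? := far y _ ya gN; have ? := far y _ ya gN'.
by apply: (@two_foreign_edges a y z y' z' x w) => //; distinct.
Qed.

Lemma at_most_two_colors : 7 <= #|K| -> (forall v, #|colors_at v| <= 3) ->
  forall v, #|colors_at v| <= 2.
Proof.
move=> K7 C3 a; rewrite leqNgt; apply/negP => Ca3.
(* At least 7 - 3 = 4 colors are missing at [a]. *)
have new s : size s < 4 -> exists g y z,
    [/\ [/\ y <> a, z <> a & y <> z], c y z = g, g \notin colors_at a & g \notin s].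
  move=> s4; have [|g] := @pick_fresh (~: colors_at a) s.
    apply: leq_trans s4 _; rewrite cardsCs setCK leq_subRL; last first.
      exact: leq_trans (C3 a) (leq_trans _ K7).
    by rewrite addnC; apply: leq_trans K7; rewrite leq_add2l.
  rewrite inE => gN gs; have [y [z [ya za yz cyz]]] := foreign_edge gN.
  by exists g, y, z; split.
(* The edges [y z1], [y z2] and [y a] already show three colors at [y]. Hence an edge of color [g]
   avoids [y], and as it must meet both [y z1] and [y z2], it is [z1 z2]. *)
have star y z1 z2 g : y <> a -> z1 <> a -> z2 <> a -> y <> z1 -> y <> z2 ->
    c y z1 \notin colors_at a -> c y z2 \notin colors_at a ->
    g \notin colors_at a ->
    uniq [:: c y z1; c y z2; g] -> c z1 z2 = g.
  move=> ya z1a z2a yz1 yz2 N1 N2 gN.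
  rewrite /= !inE !negb_or andbT => /andP[/andP[/eqP n12 /eqP n1g] /eqP n2g].
  have [p [q [pa qa pq cpq]]] := foreign_edge gN.
  have noty u : u <> y -> c y u <> g.
    move=> uy cyu; have : 4 <= #|colors_at y|.
      apply: (@uniq_sub_card _ [:: c y z1; c y z2; g; c y a]).
        have far h : h \notin colors_at a -> h <> c y a.
          by move=> hN e; move: hN; rewrite e csym mem_colors_at.
        have ? := far _ N1; have ? := far _ N2; have ? := far _ gN.
        by distinct.
      rewrite /= -cyu !mem_colors_at //; congruence.
    by rewrite leqNgt ltnS C3.
  have py : p <> y by move=> e; apply: (noty q); congruence.
  have qy : q <> y by move=> e; apply: (noty p); rewrite -?e 1?csym; congruence.
  have meet z : z <> a -> y <> z -> c y z \notin colors_at a -> c y z <> g ->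
      p = z \/ q = z.
    move=> za yz N ne; have := @foreign_edges_meet a y z p q Ca3 ya za pa qa N.
    rewrite cpq => /(_ gN ne); rewrite /= !inE !negb_or andbT.
    move: yz py qy pq => /eqP -> /nesym/eqP -> /nesym/eqP -> /eqP -> /=.
    by rewrite andbT negb_and !negbK => /orP[] /eqP ->; [left|right].
  have z12 : z1 <> z2 by congruence.
  have [e1|e1] := meet z1 z1a yz1 N1 n1g;
    have [e2|e2] := meet z2 z2a yz2 N2 n2g; try congruence.
have [g1 [y1 [z1 [[y1a z1a yz1] c1 N1 _]]]] := new [::] isT.
have [g2 [y2 [z2 [[y2a z2a yz2] c2 N2 n2]]]] := new [:: g1] isT.
have [g3 [y3 [z3 [_ _ N3 n3]]]] := new [:: g1; g2] isT.
have [g4 [y4 [z4 [_ _ N4 n4]]]] := new [:: g1; g2; g3] isT.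
move: n2 n3 n4; rewrite !inE !negb_or.
move=> /eqP n21 /andP[/eqP n31 /eqP n32] /and3P[/eqP n41 /eqP n42 /eqP n43].
(* By [star], the edge [z z'] would have both colors [g3] and [g4]. *)
have no_cherry y z z' : y <> a -> z <> a -> z' <> a -> y <> z -> y <> z' ->
    c y z = g1 -> c y z' = g2 -> False.
  move=> ? ? ? ? ? e1 e2; apply: n43.
  have <- : c z z' = g3 by apply: (@star y) => //; rewrite ?e1 ?e2 //; distinct.
  by apply/esym/(@star y) => //; rewrite ?e1 ?e2 //; distinct.
have := @foreign_edges_meet a y1 z1 y2 z2 Ca3 y1a z1a y2a z2a.
rewrite c1 c2 => /(_ N1 N2 (nesym n21)); rewrite /= !inE !negb_or andbT.
move: (yz1) (yz2) => /eqP -> /eqP -> /=; rewrite andbT !negb_and !negbK.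
have c1' : c z1 y1 = g1 by rewrite csym.
have c2' : c z2 y2 = g2 by rewrite csym.
by case/orP=> /orP[] /eqP e;
  [apply: (no_cherry y1 z1 z2) | apply: (no_cherry y1 z1 y2)
  | apply: (no_cherry z1 y1 z2) | apply: (no_cherry z1 y1 y2)] => //; congruence.
Qed.

(** Two vertices share the color of their edge, so the color sets intersect pairwise. Without a
    common color, three of them are the pairs from three colors; a vertex seeing a fourth color has
    room for only one more, which cannot lie in all three pairs. *)
Lemma common_color : 4 <= #|K| -> (forall v, #|colors_at v| <= 2) ->
  exists g, forall v, g \in colors_at v.
Proof.
move=> K4 C2.
case: (pickP [pred g | [forall v, g \in colors_at v]]) => [g /= /forallP|no].
  by exists g.
have miss g : exists v, g \notin colors_at v.
  by have /= /negbT := no g; rewrite negb_forall => /existsP.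
have two v g1 g2 g3 : g1 \in colors_at v -> g2 \in colors_at v ->
    g1 <> g2 -> g3 <> g1 -> g3 <> g2 -> g3 \notin colors_at v.
  move=> m1 m2 n12 n31 n32; apply/negP => m3; move: (C2 v).
  rewrite leqNgt => /negP; apply; apply: (@uniq_sub_card _ [:: g1; g2; g3]).
    by distinct.
  by rewrite /= m1 m2 m3.
have memc u v : u <> v -> c u v \in colors_at u /\ c u v \in colors_at v.
  by move=> uv; split; last rewrite csym; apply: mem_colors_at => //; exact: nesym.
have [|g0 _ _] := @pick_fresh setT [::]; first by rewrite cardsT; exact: leq_trans K4.
have [u [x [ux cux]]] := csurj g0.
have mu : g0 \in colors_at u by rewrite -cux mem_colors_at //; exact: nesym.
have [v nv] := miss g0.
have uv : u <> v by move=> e; rewrite -e mu in nv.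
have [buv bvu] := memc _ _ uv.
have n0 : g0 <> c u v by move=> e; rewrite -e (negbTE nv) in bvu.
have [w nw] := miss (c u v).
have uw : u <> w by move=> e; rewrite -e buv in nw.
have vw : v <> w by move=> e; rewrite -e bvu in nw.
have [auw awu] := memc _ _ uw; have [gvw gwv] := memc _ _ vw.
have n1 : c v w <> c u v by move=> e; rewrite -e gwv in nw.
have n2 : c v w <> g0 by move=> e; rewrite -e gvw in nv.
have n3 : c u w <> c u v by move=> e; rewrite -e awu in nw.
have cuw : c u w = g0.
  apply/eqP/negPn/negP => /eqP ne.
  by have := two u g0 (c u v) (c u w) mu buv n0 ne n3; rewrite auw.
rewrite cuw in auw awu.
have [|d _ /=] := @pick_fresh setT [:: g0; c u v; c v w].
  by rewrite cardsT.
rewrite !inE !negb_or => /and3P[/eqP d0 /eqP d1 /eqP d2].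
have [z [z' [zz' cz]]] := csurj d.
have mz : d \in colors_at z by rewrite -cz mem_colors_at //; exact: nesym.
have zu : z <> u by move=> e; have := two u g0 (c u v) d mu buv n0 d0 d1; rewrite -e mz.
have zv : z <> v.
  by move=> e; have := two v _ _ d bvu gvw (nesym n1) d1 d2; rewrite -e mz.
have zw : z <> w.
  by move=> e; have := two w _ _ d awu gwv (nesym n2) d0 d2; rewrite -e mz.
have [zzu zuu] := memc _ _ zu; have [zzv zvv] := memc _ _ zv.
have [zzw zww] := memc _ _ zw.
have inpair t g1 g2 h : g1 \in colors_at t -> g2 \in colors_at t -> g1 <> g2 ->
    h \in colors_at t -> h = g1 \/ h = g2.
  move=> m1 m2 n12 mh; have [|/eqP h1] := eqVneq h g1; first by left.
  have [|/eqP h2] := eqVneq h g2; first by right.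
  by have := two t g1 g2 h m1 m2 n12 h1 h2; rewrite mh.
have pu := inpair u _ _ _ mu buv n0 zuu.
have pv := inpair v _ _ _ bvu gvw (nesym n1) zvv.
have pw := inpair w _ _ _ awu gwv (nesym n2) zww.
have same h h' : h \in colors_at z -> h' \in colors_at z -> h <> d -> h' <> d -> h = h'.
  move=> mh mh' hd hd'; have [|/eqP hh] := eqVneq h h'; first by [].
  by have := two z h h' d mh mh' hh (nesym hd) (nesym hd'); rewrite mz.
have ? := same _ _ zzu zzv; have ? := same _ _ zzu zzw.
by exfalso; case: pu => ?; case: pv => ?; case: pw => ?; intuition congruence.
Qed.

(** The clique is indexed by the colors other than [g], so it has [#|K| - 1] vertices. *)
Lemma rainbow_free_mono_clique : 7 <= #|K| ->
  exists g (v : K -> T), forall i j, i <> g -> j <> g -> i <> j ->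
    v i <> v j /\ c (v i) (v j) = g.
Proof.
move=> K7.
have [a Ca|noC] := pickP [pred a | 4 <= #|colors_at a|].
  have [g gmono] := star_mono Ca (ltnW (ltnW K7)).
  have leaf i : exists x, i <> g -> x <> a /\ c a x = i.
    have [iC|iN] := boolP (i \in colors_at a).
      by case/colors_atP: iC => x xa <-; exists x.
    have [y [z [ya za yz cyz]]] := foreign_edge iN.
    (* A color missing at [a] occurs off [a] and hence equals [g], so [a] is a dummy witness. *)
    by exists a => /(_ _)[]; rewrite -cyz; exact: gmono.
  have [v vP] := fin_all_exists leaf.
  exists g, v => i j ig jg ij; have [via ci] := vP i ig; have [vja cj] := vP j jg.
  have vij : v i <> v j by congruence.
  by split=> //; apply: gmono.
have C2 := at_most_two_colors K7 _.
have {}C2 v : #|colors_at v| <= 2.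
  by apply: C2 => u; have /= /negbT := noC u; rewrite -leqNgt.
have [g gC] := common_color (ltnW (ltnW (ltnW K7))) C2.
have own i : exists x, i \in colors_at x.
  have [x [y [xy <-]]] := csurj i.
  by exists x; apply: mem_colors_at; exact: nesym.
have [v vP] := fin_all_exists own.
have two u h1 h2 : h1 \in colors_at u -> h2 \in colors_at u ->
    h1 <> g -> h2 <> g -> h1 = h2.
  move=> m1 m2 n1 n2; apply/eqP/negPn/negP => /eqP n12.
  move: (C2 u); rewrite leqNgt => /negP; apply.
  apply: (@uniq_sub_card _ [:: g; h1; h2]); first by distinct.
  by rewrite /= gC m1 m2.
(* Each vertex sees [g] and at most one other color, so vertices chosen for different colors differ,
   and their edge can only have color [g]. *)
exists g, v => i j ig jg ij.
have vij : v i <> v j by move=> e; apply/ij/(two (v i)) => //; rewrite e.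
split=> //; apply/eqP/negPn/negP => /eqP ne; apply: ij.
have mi : c (v i) (v j) \in colors_at (v i) by apply: mem_colors_at; exact: nesym.
have mj : c (v i) (v j) \in colors_at (v j) by rewrite csym; exact: mem_colors_at.
by rewrite (two _ _ _ (vP i) mi) // -(two _ _ _ (vP j) mj).
Qed.

End RainbowP5Free.

(** * Edges of graphs and embeddings of the path *)

Lemma mem_edges (G : sgraph) (e : {set G}) :
  reflect (exists x y, adj x y /\ e = [set x; y]) (e \in edges G).
Proof.
apply: (iffP imsetP) => [[[x y]]|[x [y [xy ->]]]].
  by rewrite inE /= => xy ->; exists x, y.
by exists (x, y); rewrite ?inE.
Qed.

Lemma rainbow_path5 (k n : nat) (c : {set complete_graph n} -> 'I_k)
    (v1 v2 v3 v4 v5 : 'I_n) :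
  uniq [:: v1; v2; v3; v4; v5] ->
  uniq [:: c [set v1; v2]; c [set v2; v3]; c [set v3; v4]; c [set v4; v5]] ->
  rainbow_copy c (path_graph 5).
Proof.
move=> uv uc; set s := [:: v1; v2; v3; v4; v5] in uv.
set cs := [:: _; _; _; _] in uc.
pose f (i : 'I_5) : complete_graph n := nth v1 s i.
have finj : injective f.
  by move=> i j /eqP; rewrite nth_uniq ?ltn_ord // => /eqP /val_inj.
(* Each path edge is identified by its lower end [j], which turns distinctness of the entries of
   [cs] into injectivity on edges. As [j < 4], the default [c set0] is never reached. *)
have col (e : {set path_graph 5}) : e \in edges (path_graph 5) ->
    exists j, [/\ j < 4, e = [set inord j; inord j.+1] & c (f @: e) = nth (c set0) cs j].
  case/mem_edges=> x [y [xy ->]].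
  wlog xy1 : x y xy / x.+1 = y :> nat.
    move=> W; case/orP: (xy) => /eqP h; first exact: W.
    by rewrite setUC; apply: W => //; rewrite adj_sym.
  have x4 : x < 4 by rewrite -ltnS xy1 ltn_ord.
  exists x; split=> //; first by rewrite xy1 !inord_val.
  rewrite imsetU !imset_set1 /f -xy1.
  by move: x4; case: (x : nat) => [|[|[|[|]]]].
exists f; split; first split=> // x y xy.
  by rewrite /= /complete_adj (inj_eq finj); apply: contraTneq xy => ->; rewrite adj_irrefl.
move=> e e' /col[j [j4 -> ->]] /col[j' [j4' -> ->]] /eqP.
by rewrite nth_uniq // => /eqP ->.
Qed.

(** The ceiling is taken of the positive root of x(x - 1) = 2k, and minimality of [N] places this
    root in the interval (N - 1, N]. *)
Lemma ceil_triangular_root (R : realType) (k N : nat) : 0 < k ->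
  (forall M, (k <= 'C(M, 2)) = (N <= M)) ->
  (N%:Z = Num.ceil ((1 + Num.sqrt (1 + 8 * k%:R)) / 2 : R))%R.
Proof.
move=> k0 NP.
have bin2M M : 'C(M, 2) * 2 = M * M.-1.
  by rewrite muln2 bin2 -[RHS]odd_double_half; case: M => //= M; rewrite oddM /= andNb.
have N2 : k <= 'C(N, 2) by rewrite NP.
have N1 : 'C(N.-1, 2) < k.
  rewrite ltnNge NP -ltnNge ltn_predL lt0n.
  by apply: contraTneq N2 => ->; rewrite bin0n -ltnNge.
have N0 : 1 < N by case: N N2 {NP N1} => [|[|]] //; rewrite -ltnS ltnS leqNgt k0.
set s := Num.sqrt _.
have s0 : (0 <= s)%R by exact: sqrtr_ge0.
have s2 : (s ^+ 2 = 1 + 8 * k%:R :> R)%R.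
  by rewrite sqr_sqrtr //; have := ler0n R k; lra.
have := bin2M N; have := bin2M N.-1.
(* With [N = m + 2], the binomial bounds amount to (2m + 1)^2 < [s ^+ 2] <= (2m + 3)^2. *)
case: N N0 N2 N1 {NP} => [|[|m]] //= _ N2 N1 h1 h2.
have {h1}hl : (m.+1 * m < k * 2)%N by lia.
have {N2 h2}hu : (k * 2 <= m.+2 * m.+1)%N by lia.
move: hl hu; rewrite -(ltr_nat R) -(ler_nat R) !natrM -[m.+2]addn2 -[m.+1]addn1 !natrD => hl hu.
have m0 := ler0n R m.
apply/esym/ceil_def; apply/andP; split.
  rewrite intrB -pmulrn natrD.
  rewrite ltNge; apply/negP => h.
  have : (s <= 2 * m%:R + 1)%R by lra.
  nra.
rewrite -pmulrn natrD.
rewrite leNgt; apply/negP => h.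
have : (2 * m%:R + 3 < s)%R by lra.
nra.
Qed.

(** The monochromatic clique has one vertex for each of the [k - 1] colors other than [g], which
    leaves room for [H]. *)
Lemma gallai_ramsey_P5 (k : nat) (H : sgraph) (n : nat)
    (c : {set complete_graph n} -> 'I_k) :
  6 < k -> #|H| < k -> exact_coloring c ->
  rainbow_copy c (path_graph 5) \/ monochromatic_copy c H.
Proof.
move=> k7 Hk cex.
have [P|noP] := pselect (rainbow_copy c (path_graph 5)); first by left.
right.
have [||g||g [v vP]] := @rainbow_free_mono_clique _ _ (fun x y => c [set x; y]).
- by move=> x y; rewrite setUC.
- by move=> v1 v2 v3 v4 v5 uv uc; apply/noP/(rainbow_path5 uv uc).
- have [e /mem_edges[x [y [/eqP xy ->]]] ce] := cex g.
  by exists x, y.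
- by rewrite card_ord.
have sz (x : H) : enum_rank x < size (enum [set~ g]).
  rewrite -cardE cardsC1 card_ord; apply: leq_trans (ltn_ord _) _.
  by rewrite -ltnS (ltn_predK k7).
(* Vertices of [H] are sent injectively to colors other than [g]; by [sz] the default [g] is never
   taken. *)
pose h (x : H) := nth g (enum [set~ g]) (enum_rank x).
have hg x : h x <> g.
  by have := mem_nth g (sz x); rewrite mem_enum !inE => /eqP.
have hinj : injective h.
  move=> x y /eqP; rewrite nth_uniq ?enum_uniq // => /eqP /val_inj.
  exact: enum_rank_inj.
have vh x y : x <> y -> v (h x) <> v (h y) /\ c [set v (h x); v (h y)] = g.
  by move=> xy; apply: vP => // /hinj.
exists (v \o h); split; first split.
- move=> x y /= e; apply/eqP/negPn/negP => /eqP xy.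
  by case: (vh x y xy).
- move=> x y xy; apply/eqP; apply: (vh x y _).1 => e.
  by rewrite e adj_irrefl in xy.
exists g => e /mem_edges[x [y [xy ->]]].
rewrite imsetU !imset_set1; apply: (vh x y _).2 => {}e.
by rewrite e adj_irrefl in xy.
Qed.

Theorem theorem2p1 (R : realType) (k t : nat) (H : sgraph)
  (hk7 : 7 <= k) (hkt : t + 1 <= k)
  (hH : nonempty_graph H) (hHt : #|H| = t) :
  exists2 N : nat, is_gallai_ramsey k (path_graph 5) H N &
    (N%:Z = Num.ceil ((1 + Num.sqrt (1 + 8 * k%:R)) / 2 : R))%R.
Proof.
have exN : exists N, k <= 'C(N, 2).
  (* Pascal's rule: ['C(k.+1, 2) = 'C(k, 2) + k]. *)
  exists k.+1; rewrite binS bin1; exact: leq_addl.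
case: (ex_minnP exN) => N kN Nmin.
have NP M : (k <= 'C(M, 2)) = (N <= M).
  apply/idP/idP => [|NM]; first exact: Nmin.
  exact: leq_trans kN (leq_bin2l 2 NM).
exists N; last exact: ceil_triangular_root (leq_trans _ hk7) NP.
split; last by move=> M [kM _]; exact: Nmin.
split=> // n _ c cex; apply: gallai_ramsey_P5 => //.
by rewrite hHt -addn1.
Qed.
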